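(* As an indexed preorder, Grayson's modified realizability tripos $M$ is equivalent to the tripos induced by the modification $D(K_1)^m$ of the arrow algebra $D(K_1)$. Hence $M$ is indeed a tripos.
   Context: Grayson's $M$. For $m,n\in\mathbb N$ write $mn$ for the result, if defined, of applying the $m$-th partial recursive function to $n$. Let $\Sigma_M:=\{(A_0,A_1): A_0\subseteq A_1\subseteq\mathbb N,\ 0\in A_1\}$. The functor $M:\mathbf{Set}^{\rm op}\to\mathbf{Preorder}$ sends a set $I$ to the set of functions $\alpha=(\alpha_0,\alpha_1):I\to\Sigma_M$, preordered by: $\alpha\leq_{MI}\beta$ iff there is $r\in\mathbb N$ such that for all $i\in I$: for all $n\in\alpha_1(i)$, $rn$ is defined and $rn\in\beta_1(i)$; and for all $n\in\alpha_0(i)$, $rn\in\beta_0(i)$. On morphisms $M$ acts by precomposition. Arrow algebras. An arrow structure is a complete poset $(A,\preccurlyeq)$ (infima $\bigwedge$, binary $\curlywedge$, least element $\bot$, greatest element $\top$) with a binary operation $\to$ such that $a'\preccurlyeq a$ and $b\preccurlyeq b'$ imply $a\to b\preccurlyeq a'\to b'$. The operation $\to$ associates to the right and binds stronger than $\bigwedge,\curlywedge$. A separator is a subset $S\subseteq A$ that is upwards closed, closed under modus ponens ($a\to b\in S$ and $a\in S$ imply $b\in S$), and contains $\mathbf k=\bigwedge_{a,b}a\to b\to a$, $\mathbf s=\bigwedge_{a,b,c}(a\to b\to c)\to(a\to b)\to(a\to c)$ and $\mathbf a=\bigwedge_{a\in A,\,B\subseteq\mathrm{Im}(\to)}(\bigwedge_{b\in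 B}a\to b)\to a\to\bigwedge_{b\in B}b$. An arrow algebra is an arrow structure with a separator. It is binary implicative if $a\to(b\curlywedge b')=(a\to b)\curlywedge(a\to b')$ always. $D(K_1)$ is the arrow algebra of all subsets of $\mathbb N$, ordered by inclusion, with $X\to Y=\{z\in\mathbb N:\forall x\in X\ (zx\text{ is defined and }zx\in Y)\}$ and separator the set of inhabited subsets. It is binary implicative. For a binary implicative arrow algebra $A$ with separator $S$, the arrow algebra $A^\to$ has underlying set $\{(x_0,x_1)\in A^2:x_0\preccurlyeq x_1\}$ with the pointwise order, implication $x\to y:=((x_0\to y_0)\curlywedge(x_1\to y_1),\,x_1\to y_1)$, and separator $S^\to=\{x\in A^\to:x_0\in S\}$. In an arrow algebra, $a\lor b$ denotes the join in the logical preorder ($a\vdash b$ iff $a\to b\in S$), represented by $a\lor b:=\bigwedge_c(a\to c)\to(b\to c)\to c$. A nucleus on an arrow algebra is a $\preccurlyeq$-monotone map $j$ with $\bigwedge_a a\to ja\in S$ and $\bigwedge_{a,b}(a\to jb)\to(ja\to jb)\in S$. For a nucleus $j$ on an arrow algebra $C$ with separator $S$, $C_j$ is the arrow algebra with the same underlying poset, implication $a\to_j b:=a\to jb$ and separator $S_j=\{a:ja\in S\}$. The modification of a binary implicative arrow algebra $A$ is $A^m:=(A^\to)_j$, where $j$ is the nucleus $j(x)=x\lor(\bot,\top)$ on $A^\to$. The tripos induced by an arrow algebra $(A,\preccurlyeq,\to,S)$ sends a set $I$ to $A^I$ preordered by $\varphi\vdash\psi$ iff $\bigwedge_{i\in I}\varphi(i)\to\psi(i)\in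 S$, and acts on functions by precomposition. A ($\mathbf{Set}$-based) tripos is a pseudofunctor $P:\mathbf{Set}^{\rm op}\to\mathbf{preHeyt}$ (preorders whose poset reflection is a Heyting algebra, with monotone maps preserving finite meets, finite joins and implication up to isomorphism) such that every $Pf$ has a left adjoint $\exists_f$ and a right adjoint $\forall_f$ in preorders satisfying the Beck–Chevalley condition for pullback squares of sets, and there are a set $\Sigma$ and $\sigma\in P\Sigma$ such that every $\varphi\in PI$ is isomorphic to $P[\varphi](\sigma)$ for some function $[\varphi]:I\to\Sigma$. Two indexed preorders $\mathbf{Set}^{\rm op}\to\mathbf{Preorder}$ are equivalent if there are (pseudo)natural transformations in both directions which are mutually inverse up to isomorphism. In the presence of the axiom of choice, it is equivalent to ask for one (pseudo)natural transformation that pointwise preserves and reflects the preorder and is essentially surjective. *)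

(* Defs.v *)
(* Everything is over the standard library.  Sets are types, subsets are
   [Prop]-valued predicates, and posets and preorders are [Prop]-valued. *)
From Stdlib Require Import List.
From Stdlib Require Import PropExtensionality FunctionalExtensionality
  ProofIrrelevance.
From Stdlib Require Cantor.
Import ListNotations.

Set Implicit Arguments.
Unset Strict Implicit.
Unset Printing Implicit Defensive.

(** * Partial recursive functions and Kleene's first algebra *)

(* Programs for the partial recursive functions of finitely many arguments.
   They are not indexed by an arity: a projection out of range, or a primitive
   recursion or a successor without an argument, is undefined, and superfluous
   arguments are ignored. *)
Inductive code : Type :=
| c_zero
| c_succ
| c_proj (i : nat)
| c_comp (f : code) (gs : codes)
| c_rec (f g : code)
| c_mu (f : code)
with codes : Type :=
| cs_nil
| cs_cons (g : code) (gs : codes).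

Inductive eval : code -> list nat -> nat -> Prop :=
| eval_zero l : eval c_zero l 0
| eval_succ x l : eval c_succ (x :: l) (S x)
| eval_proj i l x : nth_error l i = Some x -> eval (c_proj i) l x
| eval_comp f gs l ys z :
    evals gs l ys -> eval f ys z -> eval (c_comp f gs) l z
| eval_rec0 f g l y : eval f l y -> eval (c_rec f g) (0 :: l) y
| eval_recS f g n l y z :
    eval (c_rec f g) (n :: l) y -> eval g (n :: y :: l) z ->
    eval (c_rec f g) (S n :: l) z
| eval_mu f l n (w : nat -> nat) :
    eval f (n :: l) 0 ->
    (forall k, k < n -> eval f (k :: l) (S (w k))) ->
    eval (c_mu f) l n
with evals : codes -> list nat -> list nat -> Prop :=
| evals_nil l : evals cs_nil l []
| evals_cons g gs l y ys :
    eval g l y -> evals gs l ys -> evals (cs_cons g gs) l (y :: ys).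

Fixpoint goedel (c : code) : nat :=
  match c with
  | c_zero => Cantor.to_nat (0, 0)
  | c_succ => Cantor.to_nat (1, 0)
  | c_proj i => Cantor.to_nat (2, i)
  | c_comp f gs => Cantor.to_nat (3, Cantor.to_nat (goedel f, goedels gs))
  | c_rec f g => Cantor.to_nat (4, Cantor.to_nat (goedel f, goedel g))
  | c_mu f => Cantor.to_nat (5, goedel f)
  end
with goedels (cs : codes) : nat :=
  match cs with
  | cs_nil => 0
  | cs_cons g gs => S (Cantor.to_nat (goedel g, goedels gs))
  end.

(* [kapp m n v]: the m-th partial recursive function is defined at n, with value
   v.  It is the nowhere defined function if m is not a Goedel number. *)
Definition kapp (m n v : nat) : Prop :=
  exists c, goedel c = m /\ eval c [n] v.

(* [kapp_in m n X]: [mn] is defined and belongs to [X]. *)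
Definition kapp_in (m n : nat) (X : nat -> Prop) : Prop :=
  exists v, kapp m n v /\ X v.

(** * Indexed preorders and triposes *)

Record indexed_rel : Type := {
  fib :> Type -> Type;
  fle : forall {I : Type}, fib I -> fib I -> Prop;
  reindex : forall {I J : Type}, (I -> J) -> fib J -> fib I
}.

Definition fiso (P : indexed_rel) (I : Type) (x y : P I) : Prop :=
  fle x y /\ fle y x.

(* Pseudofunctors from Set^op to preorders; coherence is automatic. *)
Record is_indexed_preorder (P : indexed_rel) : Prop := {
  ip_refl : forall (I : Type) (x : P I), fle x x;
  ip_trans : forall (I : Type) (x y z : P I), fle x y -> fle y z -> fle x z;
  ip_mono : forall (I J : Type) (f : I -> J) (x y : P J),
    fle x y -> fle (reindex f x) (reindex f y);
  ip_id : forall (I : Type) (x : P I), fiso (reindex (fun i => i) x) x;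
  ip_comp : forall (I J K : Type) (f : I -> J) (g : J -> K) (x : P K),
    fiso (reindex (fun i => g (f i)) x) (reindex f (reindex g x))
}.

Record is_pseudonatural (P Q : indexed_rel)
    (F : forall I : Type, P I -> Q I) : Prop := {
  pn_mono : forall (I : Type) (x y : P I), fle x y -> fle (F I x) (F I y);
  pn_nat : forall (I J : Type) (f : I -> J) (x : P J),
    fiso (reindex f (F J x)) (F I (reindex f x))
}.

Definition indexed_equivalent (P Q : indexed_rel) : Prop :=
  is_indexed_preorder P /\ is_indexed_preorder Q /\
  exists (F : forall I : Type, P I -> Q I) (G : forall I : Type, Q I -> P I),
    is_pseudonatural F /\ is_pseudonatural G /\
    (forall (I : Type) (x : P I), fiso (G I (F I x)) x) /\
    (forall (I : Type) (y : Q I), fiso (F I (G I y)) y).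

Section Preorder.
Variables (T : Type) (le : T -> T -> Prop).

Definition is_top (t : T) : Prop := forall x, le x t.
Definition is_bot (b : T) : Prop := forall x, le b x.
Definition is_meet (x y m : T) : Prop :=
  forall z, le z m <-> le z x /\ le z y.
Definition is_join (x y j : T) : Prop :=
  forall z, le j z <-> le x z /\ le y z.
Definition is_imp (x y h : T) : Prop :=
  forall z m, is_meet z x m -> (le z h <-> le m y).

Record is_heyting : Prop := {
  hey_top : exists t, is_top t;
  hey_bot : exists b, is_bot b;
  hey_meet : forall x y, exists m, is_meet x y m;
  hey_join : forall x y, exists j, is_join x y j;
  hey_imp : forall x y, exists h, is_imp x y h
}.
End Preorder.

Record preserves_heyting (T U : Type) (leT : T -> T -> Prop)
    (leU : U -> U -> Prop) (h : T -> U) : Prop := {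
  ph_top : forall t, is_top leT t -> is_top leU (h t);
  ph_bot : forall b, is_bot leT b -> is_bot leU (h b);
  ph_meet : forall x y m,
    is_meet leT x y m -> is_meet leU (h x) (h y) (h m);
  ph_join : forall x y j,
    is_join leT x y j -> is_join leU (h x) (h y) (h j);
  ph_imp : forall x y i,
    is_imp leT x y i -> is_imp leU (h x) (h y) (h i)
}.

Definition is_exists (P : indexed_rel) (I J : Type) (f : I -> J)
    (E : P I -> P J) : Prop :=
  forall (x : P I) (y : P J), fle (E x) y <-> fle x (reindex f y).

Definition is_forall (P : indexed_rel) (I J : Type) (f : I -> J)
    (A : P I -> P J) : Prop :=
  forall (x : P I) (y : P J), fle y (A x) <-> fle (reindex f y) x.

(* The square with top [p : X -> I], left [q : X -> J], right [f : I -> K] and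
   bottom [g : J -> K] is a pullback. *)
Definition is_pullback (X I J K : Type) (p : X -> I) (q : X -> J)
    (f : I -> K) (g : J -> K) : Prop :=
  (forall x, f (p x) = g (q x)) /\
  (forall i j, f i = g j -> exists! x, p x = i /\ q x = j).

Record is_tripos (P : indexed_rel) : Prop := {
  tr_indexed : is_indexed_preorder P;
  tr_heyting : forall I : Type, is_heyting (@fle P I);
  tr_preserves : forall (I J : Type) (f : I -> J),
    preserves_heyting (@fle P J) (@fle P I) (reindex f);
  tr_exists : forall (I J : Type) (f : I -> J), exists E, is_exists (P := P) f E;
  tr_forall : forall (I J : Type) (f : I -> J), exists A, is_forall (P := P) f A;
  tr_exists_bc : forall (X I J K : Type) (p : X -> I) (q : X -> J)
      (f : I -> K) (g : J -> K), is_pullback p q f g ->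
    forall Ef Eq, is_exists (P := P) f Ef -> is_exists (P := P) q Eq ->
    forall x : P I, fiso (reindex g (Ef x)) (Eq (reindex p x));
  tr_forall_bc : forall (X I J K : Type) (p : X -> I) (q : X -> J)
      (f : I -> K) (g : J -> K), is_pullback p q f g ->
    forall Af Aq, is_forall (P := P) f Af -> is_forall (P := P) q Aq ->
    forall x : P I, fiso (reindex g (Af x)) (Aq (reindex p x));
  tr_generic : exists (Sigma : Type) (sigma : P Sigma),
    forall (I : Type) (x : P I), exists h : I -> Sigma,
      fiso x (reindex h sigma)
}.

(** * Grayson's modified realizability *)

Record Sigma_M : Type := {
  sm0 : nat -> Prop;
  sm1 : nat -> Prop;
  sm_sub : forall n, sm0 n -> sm1 n;
  sm_zero : sm1 0
}.

Definition grayson : indexed_rel := {|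
  fib := fun I => I -> Sigma_M;
  fle := fun I alpha beta => exists r : nat, forall i : I,
    (forall n, sm1 (alpha i) n -> kapp_in r n (sm1 (beta i))) /\
    (forall n, sm0 (alpha i) n -> kapp_in r n (sm0 (beta i)));
  reindex := fun I J f alpha i => alpha (f i)
|}.

(** * Arrow algebras *)

Record arrow_structure : Type := {
  carrier :> Type;
  ale : carrier -> carrier -> Prop;
  inf : (carrier -> Prop) -> carrier;
  arr : carrier -> carrier -> carrier;
  ale_refl : forall a, ale a a;
  ale_trans : forall a b c, ale a b -> ale b c -> ale a c;
  ale_anti : forall a b, ale a b -> ale b a -> a = b;
  inf_glb : forall (B : carrier -> Prop) a,
    ale a (inf B) <-> forall b, B b -> ale a b;
  arr_mono : forall a a' b b', ale a' a -> ale b b' -> ale (arr a b) (arr a' b')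
}.

Arguments ale {_} _ _.
Arguments inf {_} _.
Arguments arr {_} _ _.

Declare Scope arrow_scope.
Notation "a ~> b" := (arr a b) (at level 55, right associativity) : arrow_scope.
Open Scope arrow_scope.

Section ArrowOperations.
Variable A : arrow_structure.
Implicit Types (a b : A) (S : A -> Prop).

Definition infI (I : Type) (phi : I -> A) : A :=
  inf (fun x => exists i, x = phi i).
Definition meet a b : A := inf (fun x => x = a \/ x = b).
Definition top : A := inf (fun _ => False).
Definition bot : A := inf (fun _ => True).

Definition in_im_arr a : Prop := exists b c, a = b ~> c.

Definition comb_k : A := inf (fun x => exists a b, x = a ~> b ~> a).

Definition comb_s : A := inf (fun x => exists a b c,
  x = (a ~> b ~> c) ~> (a ~> b) ~> (a ~> c)).

Definition comb_a : A := inf (fun x => exists a (B : A -> Prop),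
  (forall b, B b -> in_im_arr b) /\
  x = inf (fun y => exists b, B b /\ y = a ~> b) ~> a ~> inf B).

(* An arrow algebra is an arrow structure [A] together with a subset [S] of it
   satisfying this predicate. *)
Record is_separator S : Prop := {
  sep_up : forall a b, ale a b -> S a -> S b;
  sep_mp : forall a b, S (a ~> b) -> S a -> S b;
  sep_k : S comb_k;
  sep_s : S comb_s;
  sep_a : S comb_a
}.

Definition binary_implicative : Prop :=
  forall a b b', a ~> meet b b' = meet (a ~> b) (a ~> b').

Definition ljoin a b : A := infI (fun c => (a ~> c) ~> (b ~> c) ~> c).

Definition monotone (j : A -> A) : Prop := forall a b, ale a b -> ale (j a) (j b).

Record is_nucleus S (j : A -> A) : Prop := {
  nuc_mono : monotone j;
  nuc_unit : S (infI (fun a => a ~> j a));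
  nuc_bind : S (inf (fun x => exists a b, x = (a ~> j b) ~> (j a ~> j b)))
}.

Definition arrow_tripos S : indexed_rel := {|
  fib := fun I => I -> A;
  fle := fun I phi psi => S (infI (fun i => phi i ~> psi i));
  reindex := fun I J f phi i => phi (f i)
|}.

Lemma inf_lb (B : A -> Prop) b : B b -> ale (inf B) b.
Proof. intros Hb. now apply (inf_glb B (inf B)); [apply ale_refl|]. Qed.

Lemma meet_glb a b c : ale c (meet a b) <-> ale c a /\ ale c b.
Proof.
unfold meet. rewrite inf_glb. split.
- intros H. split; apply H; auto.
- intros [Ha Hb] x [-> | ->]; assumption.
Qed.

Lemma bot_le a : ale bot a.
Proof. now apply inf_lb. Qed.

Lemma ljoin_mono b : monotone (fun a => ljoin a b).
Proof.
intros a a' Ha. apply inf_glb. intros x [c ->].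
apply ale_trans with ((a ~> c) ~> (b ~> c) ~> c).
- apply inf_lb. now exists c.
- apply arr_mono; [|apply ale_refl]. apply arr_mono; [exact Ha|apply ale_refl].
Qed.
End ArrowOperations.

(** ** The arrow algebra of subsets of the natural numbers *)

Definition DK1 : arrow_structure.
Proof.
refine {|
  carrier := nat -> Prop;
  ale := fun X Y => forall n, X n -> Y n;
  inf := fun B n => forall X, B X -> X n;
  arr := fun X Y z => forall x, X x -> kapp_in z x Y
|}.
- auto.
- auto.
- intros X Y HXY HYX. apply functional_extensionality. intros n.
  apply propositional_extensionality. split; auto.
- intros B X. split.
  + intros H Y HY n Hn. exact (H n Hn Y HY).
  + intros H n Hn Y HY. exact (H Y HY n Hn).
- intros X X' Y Y' HX HY z Hz x Hx.
  destruct (Hz x (HX x Hx)) as [v [Hv HvY]]. exists v. auto.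
Defined.

Definition DK1_sep (X : DK1) : Prop := exists n : nat, X n.

(** ** The arrow algebra of pairs *)

Record pair_carrier (A : arrow_structure) : Type := Pair {
  pr0 : A;
  pr1 : A;
  pr_le : ale pr0 pr1
}.
Arguments Pair {A} _ _ _.

Lemma pair_ext (A : arrow_structure) (x y : pair_carrier A) :
  pr0 x = pr0 y -> pr1 x = pr1 y -> x = y.
Proof.
destruct x as [x0 x1 hx], y as [y0 y1 hy]. simpl. intros -> ->.
now rewrite (proof_irrelevance _ hx hy).
Qed.

Lemma pair_inf_le (A : arrow_structure) (B : pair_carrier A -> Prop) :
  ale (inf (fun a => exists x, B x /\ a = pr0 x))
      (inf (fun a => exists x, B x /\ a = pr1 x)).
Proof.
apply inf_glb. intros a [x [Hx ->]]. apply ale_trans with (pr0 x).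
- apply inf_lb. now exists x.
- apply pr_le.
Qed.

Lemma pair_arr_le (A : arrow_structure) (x y : pair_carrier A) :
  ale (meet (pr0 x ~> pr0 y) (pr1 x ~> pr1 y)) (pr1 x ~> pr1 y).
Proof. exact (proj2 (proj1 (meet_glb _ _ _) (ale_refl _))). Qed.

Definition pair_structure (A : arrow_structure) : arrow_structure.
Proof.
refine {|
  carrier := pair_carrier A;
  ale := fun x y => ale (pr0 x) (pr0 y) /\ ale (pr1 x) (pr1 y);
  inf := fun B => Pair _ _ (pair_inf_le B);
  arr := fun x y => Pair _ _ (pair_arr_le x y)
|}.
- intros x. split; apply ale_refl.
- intros x y z [H0 H1] [K0 K1]. split; eapply ale_trans; eassumption.
- intros x y [H0 H1] [K0 K1]. apply pair_ext; now apply ale_anti.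
- intros B x. simpl. rewrite !inf_glb. split.
  + intros [H0 H1] y Hy. split; [apply H0|apply H1]; now exists y.
  + intros H. split; intros a [y [Hy ->]]; now apply H.
- intros x x' y y' [Hx0 Hx1] [Hy0 Hy1]. simpl. split.
  + apply meet_glb. split.
    * eapply ale_trans; [exact (proj1 (proj1 (meet_glb _ _ _) (ale_refl _)))|].
      now apply arr_mono.
    * eapply ale_trans; [apply pair_arr_le|]. now apply arr_mono.
  + now apply arr_mono.
Defined.

Definition pair_sep (A : arrow_structure) (S : A -> Prop) :
  pair_structure A -> Prop := fun x => S (pr0 x).

(** ** Subalgebras given by nuclei, and modifications *)

Definition nuc_structure (A : arrow_structure) (j : A -> A) (hj : monotone j) :
  arrow_structure.
Proof.
refine {|
  carrier := A;
  ale := ale;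
  inf := inf;
  arr := fun a b => a ~> j b
|}.
- apply ale_refl.
- apply ale_trans.
- apply ale_anti.
- apply inf_glb.
- intros a a' b b' Ha Hb. apply arr_mono; [exact Ha|now apply hj].
Defined.

Definition nuc_sep (A : arrow_structure) (S : A -> Prop) (j : A -> A)
  (hj : monotone j) : nuc_structure hj -> Prop := fun a => S (j a).

Definition bot_top (A : arrow_structure) : pair_structure A :=
  Pair (bot A) (top A) (bot_le (top A)).

Definition mod_nucleus (A : arrow_structure) (x : pair_structure A) :
  pair_structure A := ljoin x (bot_top A).

Lemma mod_nucleus_mono (A : arrow_structure) : monotone (@mod_nucleus A).
Proof. apply ljoin_mono. Qed.

Definition mod_structure (A : arrow_structure) : arrow_structure :=
  nuc_structure (@mod_nucleus_mono A).

Definition mod_sep (A : arrow_structure) (S : A -> Prop) :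
  mod_structure A -> Prop := nuc_sep (hj := @mod_nucleus_mono A) (pair_sep S).

(* Main.v *)
Require Import Defs.
From Stdlib Require Import List Arith Lia.
From Stdlib Require Import FunctionalExtensionality.
From Stdlib Require Cantor.
Import ListNotations.

Set Implicit Arguments.
Unset Strict Implicit.

(** A pair of sets [x0 <= x1] is a predicate on numbers over two levels, actual
    and potential realizers, that grows from the first level to the second.
    Under this reading the implication of the algebra of pairs is the Kripke
    implication ([level_arr]), and a number is in the separator if it is an
    actual realizer.  So one proof, at an unspecified level, that a number realizes
    a formula covers both components.

    The nucleus joins [(bot, top)], which has all potential and no actual
    realizers.  In such a join all that remains of this summand is the
    information that it was taken, and up to a uniform isomorphism [j x] is
    [maybe x] = ([{n + 1 : n in x0}], [{0}] together with [{n + 1 : n in x1}])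
    ([mod_nucleus_out], [mod_nucleus_in]).  Two things follow.  First, [j x] is
    in the separator of the pairs exactly if [x] is, since [0] is not an actual
    realizer ([mod_sep_level]); so the order of the tripos of the modification is
    that of maps [x -> maybe y], realized uniformly in the index
    ([modified_le]).  Secondly, [maybe x] potentially contains [0], hence is a
    truth value of Grayson.  The inclusion of these truth values into the pairs
    and [maybe] are then pseudoinverse to each other ([grayson_equivalent]): if
    [y] potentially contains [0], then [maybe y] retracts to [y] by the
    predecessor function, which sends the added [0] to that element.

    That Grayson's preorders form a tripos is shown directly, with the usual
    realizability constructions ([grayson_tripos]).  They have to contain [0]
    potentially, and do so because [0] is the program of the constant function
    [0], and also the pair of [0] and [0].

    All of this rests on the partial combinatory algebra of the partial recursive
    functions.  Its core is a universal program ([universal_program]), an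
    abstract machine for the coded programs; with the s-m-n theorem ([smn]) it
    interprets a small language of lambda terms ([realizes_eval]), in which all
    realizers are written. *)

(** * Application is single-valued *)

Scheme code_codes_ind := Induction for code Sort Prop
  with codes_code_ind := Induction for codes Sort Prop.

Lemma cantor_inj a b a' b' :
  Cantor.to_nat (a, b) = Cantor.to_nat (a', b') -> a = a' /\ b = b'.
Proof. intros H. apply Cantor.to_nat_inj in H. now injection H. Qed.

Lemma goedel_inj : forall c c', goedel c = goedel c' -> c = c'.
Proof.
apply (code_codes_ind (P := fun c => forall c', goedel c = goedel c' -> c = c')
  (P0 := fun gs => forall gs', goedels gs = goedels gs' -> gs = gs')).
1-6: intros; destruct c'; cbn [goedel] in *;
  repeat match goal with
  | H : Cantor.to_nat _ = Cantor.to_nat _ |- _ =>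
    apply cantor_inj in H; destruct H; try discriminate
  end; f_equal; auto.
- intros [|g gs]; [auto|discriminate].
- intros g IHg gs IHgs [|g' gs'] H; [discriminate|].
  cbn [goedels] in H. injection H as H.
  apply cantor_inj in H as [H1 H2]. f_equal; auto.
Qed.

Scheme eval_evals_ind := Minimality for eval Sort Prop
  with evals_eval_ind := Minimality for evals Sort Prop.

Lemma eval_deterministic c l v v' : eval c l v -> eval c l v' -> v = v'.
Proof.
intros H H'. revert c l v H v' H'.
apply (eval_evals_ind (P := fun c l v => forall v', eval c l v' -> v = v')
  (P0 := fun gs l ys => forall ys', evals gs l ys' -> ys = ys')); intros.
1-2: now inversion H.
- inversion H0; congruence.
- inversion H3 as [| | |? ? ? ys' ? Hgs Hf| | |]; subst. apply H2.
  now rewrite (H0 _ Hgs).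
- inversion H1; subst. auto.
- inversion H3 as [| | | | |? ? ? ? y' ? Hrec Hg|]; subst. apply H2.
  now rewrite (H0 _ Hrec).
- inversion H3 as [| | | | | |? ? ? w' H0' HS']; subst.
  destruct (Nat.lt_trichotomy n v') as [h|[h|h]]; auto.
  + now specialize (H0 _ (HS' n h)).
  + now specialize (H2 _ h _ H0').
- now inversion H.
- inversion H3; subst. f_equal; auto.
Qed.

Lemma kapp_functional m n v v' : kapp m n v -> kapp m n v' -> v = v'.
Proof.
intros [c [Hc H]] [c' [Hc' H']].
assert (c = c') as <- by (apply goedel_inj; congruence).
exact (eval_deterministic H H').
Qed.

(** * Computable functions *)

(** The arguments of a function of several variables are the components of a
    tuple [e : E], and [enc e] is the list that a program receives; this gives
    one set of closure lemmas for all arities. *)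
Definition computable (E : Type) (enc : E -> list nat) (f : E -> nat) : Prop :=
  exists c, forall e, eval c (enc e) (f e).

Definition enc1 (x : nat) : list nat := [x].
Definition enc2 (p : nat * nat) : list nat := [fst p; snd p].

Definition computable1 (f : nat -> nat) : Prop := computable enc1 f.
Definition computable2 (f : nat -> nat -> nat) : Prop :=
  computable enc2 (fun p => f (fst p) (snd p)).

Definition ifz (n x y : nat) : nat := match n with 0 => x | S _ => y end.

Definition tri (n : nat) : nat :=
  nat_rect (fun _ => nat) 0 (fun n y => y + S n) n.

(** The index of the diagonal, in the enumeration of [nat * nat] behind
    [Cantor.to_nat], on which the [n]-th pair lies. *)
Definition diag (n : nat) : nat :=
  nat_rect (fun _ => nat) 0
    (fun n d => ifz (tri (S d) - S n) (S d) d) n.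

Definition pair (x y : nat) : nat := Cantor.to_nat (x, y).
Definition p1 (n : nat) : nat := fst (Cantor.of_nat n).
Definition p2 (n : nat) : nat := snd (Cantor.of_nat n).

Section Closure.
Variables (E : Type) (enc : E -> list nat).

Lemma computable_proj i f :
  (forall e, nth_error (enc e) i = Some (f e)) -> computable enc f.
Proof. intros H. exists (c_proj i). intros e. now constructor. Qed.

Lemma computable_comp g f :
  computable1 g -> computable enc f -> computable enc (fun e => g (f e)).
Proof.
intros [c Hc] [d Hd]. exists (c_comp c (cs_cons d cs_nil)). intros e.
econstructor; [|apply Hc]. repeat constructor. apply Hd.
Qed.

Lemma computable_comp2 g f f' :
  computable2 g -> computable enc f -> computable enc f' ->
  computable enc (fun e => g (f e) (f' e)).
Proof.
intros [c Hc] [d Hd] [d' Hd'].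
exists (c_comp c (cs_cons d (cs_cons d' cs_nil))). intros e.
econstructor; [|apply (Hc (f e, f' e))]. repeat constructor; auto.
Qed.

Lemma computable_succ f :
  computable enc f -> computable enc (fun e => S (f e)).
Proof.
apply (computable_comp (g := S)). exists c_succ. constructor.
Qed.

Lemma computable_const n : computable enc (fun _ => n).
Proof.
induction n as [|n IH].
- exists c_zero. constructor.
- now apply computable_succ.
Qed.

Lemma computable_ifz f g h :
  computable enc f -> computable enc g -> computable enc h ->
  computable enc (fun e => ifz (f e) (g e) (h e)).
Proof.
intros [a Ha] [b Hb] [c Hc].
exists (c_comp (c_rec (c_proj 0) (c_proj 3))
  (cs_cons a (cs_cons b (cs_cons c cs_nil)))).
intros e. apply eval_comp with [f e; g e; h e].
- repeat constructor; auto.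
- induction (f e) as [|n IH]; econstructor; [now constructor|exact IH|].
  now constructor.
Qed.
End Closure.

Lemma computable1_id : computable1 (fun x => x).
Proof. now apply computable_proj with 0. Qed.

Lemma computable2_fst : computable enc2 (fun p => fst p).
Proof. now apply computable_proj with 0. Qed.

Lemma computable2_snd : computable enc2 (fun p => snd p).
Proof. now apply computable_proj with 1. Qed.

Lemma computable_rec b g :
  computable2 g -> computable1 (nat_rect (fun _ => nat) b g).
Proof.
intros [c Hc]. destruct (@computable_const _ (fun _ : unit => @nil nat) b)
  as [d Hd].
exists (c_rec d c). intros n. unfold enc1.
induction n as [|n IH]; econstructor.
- exact (Hd tt).
- exact IH.
- apply (Hc (n, _)).
Qed.

Lemma computable_iter f :
  computable1 f -> computable2 (fun n x => Nat.iter n f x).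
Proof.
intros [c Hc]. exists (c_rec (c_proj 0) (c_comp c (cs_cons (c_proj 1) cs_nil))).
intros [n x]. unfold enc2. cbn [fst snd].
induction n as [|n IH]; econstructor.
- now constructor.
- exact IH.
- apply eval_comp with [Nat.iter n f x]; [|apply Hc].
  now repeat constructor.
Qed.

Ltac computability :=
  repeat first
    [ assumption | apply computable1_id | apply computable2_fst
    | apply computable2_snd | apply computable_const | apply computable_succ
    | apply computable_ifz ].

Lemma computable_pred E (enc : E -> list nat) f :
  computable enc f -> computable enc (fun e => pred (f e)).
Proof.
apply computable_comp.
destruct (@computable_rec 0 (fun n _ => n)) as [c Hc]; [apply computable2_fst|].
exists c. intros [|n]; apply Hc.
Qed.

Lemma computable_add E (enc : E -> list nat) f g :
  computable enc f -> computable enc g -> computable enc (fun e => f e + g e).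
Proof.
apply computable_comp2.
destruct (@computable_iter S) as [c Hc]; [computability|].
exists c. intros e. specialize (Hc e). cbv beta in *.
replace (fst e + snd e) with (Nat.iter (fst e) S (snd e)); [exact Hc|].
clear Hc. induction (fst e) as [|n IH]; [reflexivity|]. exact (f_equal S IH).
Qed.

Lemma computable_sub E (enc : E -> list nat) f g :
  computable enc f -> computable enc g -> computable enc (fun e => f e - g e).
Proof.
intros Hf Hg.
apply (computable_comp2 (g := fun x y => y - x)); [|exact Hg|exact Hf].
destruct (@computable_iter pred) as [c Hc];
  [apply computable_pred, computable1_id|].
exists c. intros e. specialize (Hc e). cbv beta in *.
replace (snd e - fst e) with (Nat.iter (fst e) pred (snd e)); [exact Hc|].
clear Hc. induction (fst e) as [|n IH]; [simpl; lia|].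
change (pred (Nat.iter n pred (snd e)) = snd e - S n). lia.
Qed.

Lemma computable_tri E (enc : E -> list nat) f :
  computable enc f -> computable enc (fun e => tri (f e)).
Proof.
apply computable_comp. apply computable_rec.
apply computable_add; computability.
Qed.

Lemma computable_diag E (enc : E -> list nat) f :
  computable enc f -> computable enc (fun e => diag (f e)).
Proof.
apply computable_comp. apply computable_rec.
apply computable_ifz; computability.
apply computable_sub; computability. apply computable_tri. computability.
Qed.

Lemma tri_S n : tri (S n) = tri n + S n.
Proof. reflexivity. Qed.

Lemma tri_mono m n : m <= n -> tri m <= tri n.
Proof. induction 1; [lia|]. rewrite tri_S. lia. Qed.

Lemma diag_spec n : tri (diag n) <= n < tri (S (diag n)).
Proof.
induction n as [|n IH]; [cbn; lia|].
change (diag (S n)) with (ifz (tri (S (diag n)) - S n) (S (diag n)) (diag n)).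
destruct (tri (S (diag n)) - S n) eqn:H; cbn [ifz];
  rewrite ?tri_S in *; lia.
Qed.

Lemma pair_tri x y : pair x y = tri (x + y) + y.
Proof.
unfold pair, Cantor.to_nat. rewrite Nat.add_comm, (Nat.add_comm y x). f_equal.
induction (x + y) as [|n IH]; [reflexivity|]. rewrite tri_S, <- IH. simpl. lia.
Qed.

Lemma diag_pair x y : diag (pair x y) = x + y.
Proof.
pose proof (diag_spec (pair x y)) as [H1 H2].
set (d := diag (pair x y)) in *. rewrite pair_tri in H1, H2.
destruct (Nat.lt_trichotomy d (x + y)) as [h|[h|h]]; [|exact h|].
- apply (tri_mono (m := S d)) in h. lia.
- apply (tri_mono (m := S (x + y))) in h. rewrite tri_S in h. lia.
Qed.

Lemma p1_pair x y : p1 (pair x y) = x.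
Proof. unfold p1, pair. now rewrite Cantor.cancel_of_to. Qed.

Lemma p2_pair x y : p2 (pair x y) = y.
Proof. unfold p2, pair. now rewrite Cantor.cancel_of_to. Qed.

Lemma pair_p n : pair (p1 n) (p2 n) = n.
Proof.
unfold pair, p1, p2. now rewrite <- surjective_pairing, Cantor.cancel_to_of.
Qed.

Lemma p2_diag n : p2 n = n - tri (diag n).
Proof. rewrite <- (pair_p n) at 2 3. rewrite diag_pair, pair_tri. lia. Qed.

Lemma p1_diag n : p1 n = diag n - (n - tri (diag n)).
Proof.
rewrite <- p2_diag. rewrite <- (pair_p n) at 2. rewrite diag_pair. lia.
Qed.

Lemma computable_pair E (enc : E -> list nat) f g :
  computable enc f -> computable enc g ->
  computable enc (fun e => pair (f e) (g e)).
Proof.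
intros Hf Hg. apply (computable_comp2 (g := pair)); [|exact Hf|exact Hg].
destruct (@computable_add _ enc2 (fun p => tri (fst p + snd p))
  (fun p => snd p)) as [c Hc].
- apply computable_tri, computable_add; computability.
- computability.
- exists c. intros e. rewrite pair_tri. apply Hc.
Qed.

Lemma computable_p2 E (enc : E -> list nat) f :
  computable enc f -> computable enc (fun e => p2 (f e)).
Proof.
apply computable_comp.
replace p2 with (fun n => n - tri (diag n))
  by (apply functional_extensionality; intros; now rewrite p2_diag).
apply computable_sub; [|apply computable_tri, computable_diag]; computability.
Qed.

Lemma computable_p1 E (enc : E -> list nat) f :
  computable enc f -> computable enc (fun e => p1 (f e)).
Proof.
apply computable_comp.
replace p1 with (fun n => diag n - (n - tri (diag n)))
  by (apply functional_extensionality; intros; now rewrite p1_diag).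
apply computable_sub; [|apply computable_sub; [|apply computable_tri]];
  try apply computable_diag; computability.
Qed.

Lemma to_nat_pair x y : Cantor.to_nat (x, y) = pair x y.
Proof. reflexivity. Qed.

Global Opaque pair p1 p2.

Ltac computability ::=
  repeat first
    [ assumption | apply computable1_id | apply computable2_fst
    | apply computable2_snd | apply computable_const | apply computable_succ
    | apply computable_ifz | apply computable_pair | apply computable_p1
    | apply computable_p2 | apply computable_pred | apply computable_add
    | apply computable_sub ].

(** * A universal program *)

(** Programs are run by an abstract machine whose states are numbers.  Lists,
    of arguments as well as of pending frames, are coded like [goedels] codes
    [codes], so that the empty list is [0]. *)
Definition consn (x l : nat) : nat := S (pair x l).
Definition hdn (l : nat) : nat := p1 (pred l).
Definition tln (l : nat) : nat := p2 (pred l).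

Fixpoint codel (l : list nat) : nat :=
  match l with [] => 0 | x :: l => consn x (codel l) end.

Definition state (mode a b K : nat) : nat := pair mode (pair a (pair b K)).
Definition st_mode (s : nat) : nat := p1 s.
Definition st_a (s : nat) : nat := p1 (p2 s).
Definition st_b (s : nat) : nat := p1 (p2 (p2 s)).
Definition st_K (s : nat) : nat := p2 (p2 (p2 s)).

(** The three modes of the machine: it evaluates a program, it evaluates a list
    of programs, or it returns a value. *)
Definition ev (c l K : nat) : nat := state 0 c l K.
Definition evs (gs l K : nat) : nat := state 1 gs l K.
Definition ret (v K : nat) : nat := state 2 v 0 K.

(** A frame says what happens to the next returned value: [f] is applied to it;
    [g] is evaluated as well, for its value to be put in front of it; it is
    itself put in front of [ys]; it is the [n]-th value of a primitive recursion;
    it is the value at [k] in the search for a zero of [f].  In a list of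
    programs the last one comes first, so that results need no reversal. *)
Definition frame (tag x y z : nat) : nat := pair tag (pair x (pair y z)).
Definition f_app (f : nat) : nat := frame 0 f 0 0.
Definition f_head (g l : nat) : nat := frame 1 g l 0.
Definition f_cons (ys : nat) : nat := frame 2 ys 0 0.
Definition f_rec (g n l : nat) : nat := frame 3 g n l.
Definition f_mu (f k l : nat) : nat := frame 4 f k l.

Definition step_eval (c l K : nat) : nat :=
  let tag := p1 c in
  let d := p2 c in
  ifz tag (ret 0 K)
  (ifz (pred tag) (ret (S (hdn l)) K)
  (ifz (pred (pred tag))
     (ifz d (ret (hdn l) K) (ev (pair 2 (pred d)) (tln l) K))
  (ifz (pred (pred (pred tag))) (evs (p2 d) l (consn (f_app (p1 d)) K))
  (ifz (pred (pred (pred (pred tag))))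
     (ifz (hdn l) (ev (p1 d) (tln l) K)
        (ev c (consn (pred (hdn l)) (tln l))
           (consn (f_rec (p2 d) (pred (hdn l)) (tln l)) K)))
     (ev d (consn 0 l) (consn (f_mu d 0 l) K)))))).

Definition step_evals (gs l K : nat) : nat :=
  ifz gs (ret 0 K) (evs (tln gs) l (consn (f_head (hdn gs) l) K)).

Definition step_return (a fr K : nat) : nat :=
  let tag := p1 fr in
  let x := p1 (p2 fr) in
  let y := p1 (p2 (p2 fr)) in
  let z := p2 (p2 (p2 fr)) in
  ifz tag (ev x a K)
  (ifz (pred tag) (ev x y (consn (f_cons a) K))
  (ifz (pred (pred tag)) (ret (consn a x) K)
  (ifz (pred (pred (pred tag))) (ev x (consn y (consn a z)) K)
     (ifz a (ret y K)
        (ev x (consn (S y) z) (consn (f_mu x (S y) z) K)))))).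

Definition step (s : nat) : nat :=
  ifz (st_mode s) (step_eval (st_a s) (st_b s) (st_K s))
  (ifz (pred (st_mode s)) (step_evals (st_a s) (st_b s) (st_K s))
  (ifz (st_K s) s (step_return (st_a s) (hdn (st_K s)) (tln (st_K s))))).

(** A number that vanishes in the final states, as this is what minimization
    can search for. *)
Definition running (s : nat) : nat := (2 - st_mode s) + st_K s.

Lemma computable_step : computable1 step.
Proof.
unfold computable1, step, step_eval, step_evals, step_return, ev, evs, ret,
  f_app, f_head, f_cons, f_rec, f_mu, frame, hdn, tln, consn, state, st_mode,
  st_a, st_b, st_K.
cbv zeta. computability.
Qed.

Lemma hdn_consn x l : hdn (consn x l) = x.
Proof. apply p1_pair. Qed.

Lemma tln_consn x l : tln (consn x l) = l.
Proof. apply p2_pair. Qed.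

Lemma hdn_S x l : hdn (S (pair x l)) = x.
Proof. apply p1_pair. Qed.

Lemma tln_S x l : tln (S (pair x l)) = l.
Proof. apply p2_pair. Qed.

Lemma step_ev c l K : step (ev c l K) = step_eval c l K.
Proof.
unfold step, ev, state, st_mode, st_a, st_b, st_K.
now rewrite !p2_pair, !p1_pair.
Qed.

Lemma step_evs gs l K : step (evs gs l K) = step_evals gs l K.
Proof.
unfold step, evs, state, st_mode, st_a, st_b, st_K.
now rewrite !p2_pair, !p1_pair.
Qed.

Lemma step_ret a fr K : step (ret a (consn fr K)) = step_return a fr K.
Proof.
unfold step, ret, state, st_mode, st_a, st_b, st_K.
now rewrite !p2_pair, !p1_pair, hdn_consn, tln_consn.
Qed.

Definition reach (s s' : nat) : Prop := exists k, Nat.iter k step s = s'.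

Lemma reach_refl s : reach s s.
Proof. now exists 0. Qed.

Lemma reach_step s s' : reach (step s) s' -> reach s s'.
Proof.
intros [k H]. exists (S k).
rewrite Nat.iter_succ_r. exact H.
Qed.

Lemma reach_trans s s' s'' : reach s s' -> reach s' s'' -> reach s s''.
Proof.
intros [k H] [k' H']. exists (k' + k). rewrite Nat.iter_add. congruence.
Qed.

Ltac machine :=
  apply reach_step;
  rewrite ?step_ev, ?step_evs, ?step_ret;
  cbn [goedel goedels codel];
  unfold step_eval, step_evals, step_return, f_app, f_head, f_cons, f_rec, f_mu,
    frame;
  cbv zeta;
  rewrite ?to_nat_pair, ?hdn_consn, ?tln_consn, ?hdn_S, ?tln_S, ?p2_pair, ?p1_pair;
  cbn [ifz pred].

Lemma reach_proj l i x K :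
  nth_error l i = Some x -> reach (ev (pair 2 i) (codel l) K) (ret x K).
Proof.
revert l. induction i as [|i IH]; intros [|y l] H; try discriminate; machine.
- injection H as ->. apply reach_refl.
- now apply IH.
Qed.

(** Downward induction on the argument at which the search has arrived. *)
Lemma reach_search (f l : nat) K n w :
  (forall k K', k < n -> reach (ev f (consn k l) K') (ret (S (w k)) K')) ->
  (forall K', reach (ev f (consn n l) K') (ret 0 K')) ->
  reach (ev f (consn 0 l) (consn (f_mu f 0 l) K)) (ret n K).
Proof.
intros Hlt Hn.
assert (H : forall k, k <= n ->
  reach (ev f (consn (n - k) l) (consn (f_mu f (n - k) l) K)) (ret n K)).
- induction k as [|k IH]; intros Hk.
  + rewrite Nat.sub_0_r. eapply reach_trans; [apply Hn|]. machine.
    apply reach_refl.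
  + eapply reach_trans; [apply Hlt; lia|]. machine.
    replace (S (n - S k)) with (n - k) by lia. apply IH. lia.
- specialize (H n (le_n n)). now rewrite Nat.sub_diag in H.
Qed.

(** The continuation [K] is arbitrary, so that the machine can run the program
    as a part of a larger one. *)
Lemma reach_eval c l v :
  eval c l v -> forall K, reach (ev (goedel c) (codel l) K) (ret v K).
Proof.
revert c l v.
apply (eval_evals_ind
  (P := fun c l v => forall K, reach (ev (goedel c) (codel l) K) (ret v K))
  (P0 := fun gs l ys => forall K,
    reach (evs (goedels gs) (codel l) K) (ret (codel ys) K))); intros.
- machine. apply reach_refl.
- machine. apply reach_refl.
- cbn [goedel]. rewrite to_nat_pair. now apply reach_proj.
- machine. eapply reach_trans; [apply H0|]. machine. apply H2.
- machine. apply H0.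
- machine. eapply reach_trans; [apply (H0 (consn _ _))|]. machine. apply H2.
- machine. apply reach_search with w; [|exact H0].
  intros k K' Hk. now apply H2.
- machine. apply reach_refl.
- machine. eapply reach_trans; [apply H2|]. machine.
  eapply reach_trans; [apply H0|]. machine. apply reach_refl.
Qed.

Lemma running_state m a b K : running (state m a b K) = (2 - m) + K.
Proof.
unfold running, state, st_mode, st_K. now rewrite !p2_pair, !p1_pair.
Qed.

Lemma step_stopped s : running s = 0 -> step s = s.
Proof.
unfold running, step. intros H.
destruct (st_mode s) as [|[|m]]; [lia..|].
destruct (st_K s); [reflexivity|lia].
Qed.

Lemma least_zero (f : nat -> nat) n :
  f n = 0 -> exists k, k <= n /\ f k = 0 /\ forall i, i < k -> f i <> 0.
Proof.
intros Hn. destruct (Wf_nat.dec_inh_nat_subset_has_unique_least_element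
  (fun k => f k = 0)) as [k [[Hk Hmin] _]].
- intros k. destruct (Nat.eq_dec (f k) 0); auto.
- now exists n.
- exists k. split; [now apply Hmin|]. split; [exact Hk|].
  intros i Hi Hfi. apply Hmin in Hfi. lia.
Qed.

Definition initial (s : nat) : nat := ev (p1 s) (consn (p2 s) 0) 0.

(** Kleene's enumeration theorem: run the machine up to the first time at which
    it has stopped.  The machine rests in a final state, so this first time
    gives the same result as any later one. *)
Lemma universal_program :
  exists U, forall m n v, kapp m n v -> eval U [pair m n] v.
Proof.
assert (Hrun : computable enc2
  (fun p => running (Nat.iter (fst p) step (initial (snd p))))).
{ apply (computable_comp (g := running)).
  - unfold running, st_mode, st_K, computable1. computability.
  - apply (computable_comp2 (g := fun n x => Nat.iter n step x)).
    + apply computable_iter, computable_step.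
    + computability.
    + unfold initial, ev, state, consn. computability. }
assert (Hout : computable enc2
  (fun p => st_a (Nat.iter (fst p) step (initial (snd p))))).
{ apply (computable_comp (g := st_a)).
  - unfold st_a, computable1. computability.
  - apply (computable_comp2 (g := fun n x => Nat.iter n step x)).
    + apply computable_iter, computable_step.
    + computability.
    + unfold initial, ev, state, consn. computability. }
destruct Hrun as [r Hr], Hout as [o Ho].
exists (c_comp o (cs_cons (c_mu r) (cs_cons (c_proj 0) cs_nil))).
intros m n v [c [<- Hc]].
destruct (reach_eval Hc 0) as [N HN]. cbn [codel] in HN.
assert (Hinit : initial (pair (goedel c) n) = ev (goedel c) (consn n 0) 0)
  by (unfold initial; now rewrite p1_pair, p2_pair).
rewrite <- Hinit in HN. set (s := initial (pair (goedel c) n)) in *.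
destruct (@least_zero (fun k => running (Nat.iter k step s)) N)
  as [k [HkN [Hk Hmin]]].
{ rewrite HN. unfold ret. now rewrite running_state. }
assert (Hv : Nat.iter k step s = ret v 0).
{ rewrite <- HN. replace N with ((N - k) + k) by lia. rewrite Nat.iter_add.
  induction (N - k) as [|d IH]; [reflexivity|].
  cbn [Nat.iter nat_rect]. change (nat_rect _ ?x (fun _ => step) d) with
    (Nat.iter d step x). rewrite <- IH. symmetry. now apply step_stopped. }
apply eval_comp with [k; pair (goedel c) n].
- constructor; [|now repeat constructor].
  apply eval_mu with
    (fun i => pred (running (Nat.iter i step s))).
  + rewrite <- Hk. apply (Hr (k, pair (goedel c) n)).
  + intros i Hi. rewrite Nat.succ_pred by now apply Hmin.
    apply (Hr (i, pair (goedel c) n)).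
- replace v with (st_a (Nat.iter k step s));
    [apply (Ho (k, pair (goedel c) n))|].
  rewrite Hv. unfold st_a, ret, state. now rewrite p2_pair, p1_pair.
Qed.

(** * A language of realizers *)

Fixpoint numeral (x : nat) : code :=
  match x with
  | 0 => c_zero
  | S x => c_comp c_succ (cs_cons (numeral x) cs_nil)
  end.

Lemma eval_numeral x l : eval (numeral x) l x.
Proof.
induction x as [|x IH]; cbn; [constructor|].
apply eval_comp with [x]; now repeat constructor.
Qed.

Lemma computable_numeral : computable1 (fun x => goedel (numeral x)).
Proof.
destruct (@computable_rec (goedel c_zero)
  (fun _ g => pair 3 (pair (goedel c_succ) (S (pair g 0))))) as [c Hc].
- computability.
- exists c. intros x. specialize (Hc x). cbv beta in *.
  replace (goedel (numeral x)) with
    (nat_rect (fun _ => nat) (goedel c_zero)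
      (fun _ g => pair 3 (pair (goedel c_succ) (S (pair g 0)))) x); [exact Hc|].
  clear Hc. induction x as [|x IH]; [reflexivity|].
  cbn [nat_rect]. rewrite IH. reflexivity.
Qed.

(** The s-m-n theorem: the parameter [e] is built into the program as a
    numeral. *)
Lemma smn c :
  exists clos, computable1 clos /\
    forall e y v, eval c [pair y e] v -> kapp (clos e) y v.
Proof.
destruct (@computable_pair _ enc2 (fun p => fst p) (fun p => snd p)) as [p Hp];
  [computability..|].
set (body e := c_comp c (cs_cons
  (c_comp p (cs_cons (c_proj 0) (cs_cons (numeral e) cs_nil))) cs_nil)).
exists (fun e => goedel (body e)). split.
- replace (fun e => goedel (body e)) with
    (fun e => pair 3 (pair (goedel c) (S (pair (pair 3 (pair (goedel p)
       (S (pair (goedel (c_proj 0)) (S (pair (goedel (numeral e)) 0)))))) 0))))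
    by reflexivity.
  unfold computable1. computability. apply computable_numeral.
- intros e y v H. exists (body e). split; [reflexivity|].
  apply eval_comp with [pair y e]; [|exact H].
  repeat constructor. apply eval_comp with [y; e]; [|apply (Hp (y, e))].
  repeat constructor. apply eval_numeral.
Qed.

(** Realizers are written as lambda terms with de Bruijn indices, over the
    numbers with any computable functions as operations. *)
Inductive term : Type :=
| Var (i : nat)
| Num (n : nat)
| Op (f : nat -> nat) (Hf : computable1 f) (t : term)
| Pr (t u : term)
| App (t u : term)
| Lam (t : term)
| Case (t u v : term).

Declare Scope term_scope.
Notation "t @ u" := (App t u) (at level 40, left associativity) : term_scope.
Open Scope term_scope.

(** [realizes t l X] says that in the environment [l] the term [t] has a value in
    [X].  Terms are read as transformers of postconditions, which makes it
    unnecessary to name intermediate values; of the code of a function nothing is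
    known but how it acts. *)
Fixpoint realizes (t : term) (l : list nat) (X : nat -> Prop) : Prop :=
  match t with
  | Var i => match nth_error l i with Some n => X n | None => False end
  | Num n => X n
  | @Op f _ t => realizes t l (fun n => X (f n))
  | Pr t u => realizes t l (fun m => realizes u l (fun n => X (pair m n)))
  | App t u => realizes t l (fun m => realizes u l (fun n => kapp_in m n X))
  | Lam t => forall m,
      (forall n Y, realizes t (n :: l) Y -> kapp_in m n Y) -> X m
  | Case t u v => realizes t l (fun n =>
      match n with 0 => realizes u l X | S n => realizes v (n :: l) X end)
  end.

Definition code_env (l : list nat) : nat := fold_right pair 0 l.

(** Terms compile to programs, which find the environment in their argument:
    application is the universal program, and abstraction the s-m-n theorem. *)
Lemma realizes_eval t :
  exists c, forall l X, realizes t l X ->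
    exists v, eval c [code_env l] v /\ X v.
Proof.
destruct universal_program as [U HU].
assert (Happ : forall f g, computable1 f -> computable1 g ->
  exists c, forall e v, kapp (f e) (g e) v -> eval c [e] v).
{ intros f g Hf Hg. destruct (@computable_pair _ enc1 f g Hf Hg) as [p Hp].
  exists (c_comp U (cs_cons p cs_nil)). intros e v H.
  apply eval_comp with [pair (f e) (g e)]; [|now apply HU].
  repeat constructor. apply Hp. }
assert (Hpair : forall c d, exists p, forall e m n,
  eval c [e] m -> eval d [e] n -> eval p [e] (pair m n)).
{ intros c d. destruct (@computable_pair _ enc2 (fun p => fst p) (fun p => snd p))
    as [p Hp]; [computability..|].
  exists (c_comp p (cs_cons c (cs_cons d cs_nil))). intros e m n Hm Hn.
  apply eval_comp with [m; n]; [|apply (Hp (m, n))]. now repeat constructor. }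
induction t as [i|n|f Hf t [c Hc]|t [c Hc] u [d Hd]|t [c Hc] u [d Hd]|t [c Hc]
  |t [c Hc] u [d Hd] v [d' Hd']]; cbn [realizes].
- assert (Hi : computable1 (fun e => p1 (Nat.iter i p2 e))).
  { apply (computable_comp (g := p1)); [unfold computable1; computability|].
    apply (computable_comp2 (g := fun n x => Nat.iter n p2 x));
      [apply computable_iter; unfold computable1|..]; computability. }
  destruct Hi as [c Hc]. exists c. intros l X.
  destruct (nth_error l i) as [n|] eqn:H; [|tauto]. intros HX. exists n.
  split; [|exact HX].
  replace n with (p1 (Nat.iter i p2 (code_env l))); [apply Hc|].
  clear Hc X HX. revert l H. induction i as [|i IH]; intros [|m l] H;
    try discriminate.
  + injection H as ->. apply p1_pair.
  + rewrite Nat.iter_succ_r. cbn [code_env fold_right]. rewrite p2_pair.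
    now apply IH.
- exists (numeral n). intros l X HX. exists n. split; [apply eval_numeral|].
  exact HX.
- destruct Hf as [d Hd]. exists (c_comp d (cs_cons c cs_nil)). intros l X HX.
  destruct (Hc l _ HX) as [n [Hn HXn]]. exists (f n). split; [|exact HXn].
  apply eval_comp with [n]; [|apply Hd]. now repeat constructor.
- destruct (Hpair c d) as [p Hp]. exists p. intros l X HX.
  destruct (Hc l _ HX) as [m [Hm HXm]]. destruct (Hd l _ HXm) as [n [Hn HXn]].
  exists (pair m n). auto.
- destruct (Hpair c d) as [p Hp]. exists (c_comp U (cs_cons p cs_nil)).
  intros l X HX.
  destruct (Hc l _ HX) as [m [Hm HXm]].
  destruct (Hd l _ HXm) as [n [Hn [v [Hv HXv]]]].
  exists v. split; [|exact HXv].
  apply eval_comp with [pair m n]; [|now apply HU]. repeat constructor. auto.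
- destruct (smn c) as [clos [[d Hd] Hclos]]. exists d. intros l X HX.
  exists (clos (code_env l)). split; [apply Hd|]. apply HX.
  intros n Y HY. destruct (Hc _ _ HY) as [v [Hv HYv]]. exists v. split; auto.
- (* Both branches are abstracted before one of them is selected: primitive
     recursion evaluates the branch for zero in any case. *)
  assert (H2 : computable1 p2) by (unfold computable1; computability).
  destruct H2 as [q Hq].
  destruct (smn (c_comp d (cs_cons q cs_nil))) as [f [Hf Hfd]].
  destruct (smn d') as [g [Hg Hgd]].
  assert (Hf2 : computable1 (fun s => f (p2 s)))
    by (apply (computable_comp (g := f)); [exact Hf|computability]).
  assert (Hg2 : computable1 (fun s => g (p2 s)))
    by (apply (computable_comp (g := g)); [exact Hg|computability]).
  destruct (Happ (fun s => ifz (p1 s) (f (p2 s)) (g (p2 s)))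
    (fun s => pred (p1 s))) as [a Ha]; [unfold computable1; computability..|].
  destruct (Hpair c (c_proj 0)) as [p Hp].
  exists (c_comp a (cs_cons p cs_nil)). intros l X HX.
  destruct (Hc l _ HX) as [n [Hn HXn]].
  assert (H : exists v, kapp (ifz n (f (code_env l)) (g (code_env l)))
    (pred n) v /\ X v).
  { destruct n as [|n].
    - destruct (Hd _ _ HXn) as [v0 [Hv HXv]]. exists v0. split; [|exact HXv].
      apply Hfd. apply eval_comp with [code_env l]; [|exact Hv].
      repeat constructor. rewrite <- (p2_pair 0 (code_env l)) at 2. apply Hq.
    - destruct (Hd' _ _ HXn) as [v0 [Hv HXv]]. exists v0. split; [|exact HXv].
      now apply Hgd. }
  destruct H as [v0 [Hv HXv]]. exists v0. split; [|exact HXv].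
  apply eval_comp with [pair n (code_env l)].
  + repeat constructor. apply Hp; [exact Hn|now constructor].
  + apply Ha. now rewrite p1_pair, p2_pair.
Qed.

Lemma realizable t X : realizes t [] X -> exists n, X n.
Proof.
destruct (realizes_eval t) as [c Hc]. intros H.
destruct (Hc [] X H) as [v [_ Hv]]. now exists v.
Qed.

Lemma realizes_mono t l X Y :
  (forall n, X n -> Y n) -> realizes t l X -> realizes t l Y.
Proof.
revert l X Y. induction t; intros l X Y HXY; cbn [realizes].
- destruct (nth_error l i); auto.
- auto.
- apply IHt. auto.
- apply IHt1. intros m. apply IHt2. auto.
- apply IHt1. intros m. apply IHt2. intros n [v [Hv HX]]. exists v. auto.
- auto.
- apply IHt1. intros [|n]; [apply IHt2|apply IHt3]; auto.
Qed.

Lemma kapp_in_mono m n X Y :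
  (forall v, X v -> Y v) -> kapp_in m n X -> kapp_in m n Y.
Proof. intros H [v [Hv HX]]. exists v. auto. Qed.

Lemma realizable_fun t :
  exists r, forall n Y, realizes t [n] Y -> kapp_in r n Y.
Proof. apply (realizable (t := Lam t)). cbn [realizes]. auto. Qed.

Lemma computable1_S : computable1 S.
Proof. unfold computable1. computability. Qed.

Lemma computable1_p1 : computable1 p1.
Proof. unfold computable1. computability. Qed.

Lemma computable1_p2 : computable1 p2.
Proof. unfold computable1. computability. Qed.

Definition Suc : term -> term := Op computable1_S.
Definition Fst : term -> term := Op computable1_p1.
Definition Snd : term -> term := Op computable1_p2.

Lemma kapp_in_0 n (X : nat -> Prop) : X 0 -> kapp_in 0 n X.
Proof.
intros H. exists 0. split; [|exact H].
exists c_zero. split; [reflexivity|constructor].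
Qed.

(** * The arrow algebra of subsets of the natural numbers *)

Lemma DK1_is_separator : is_separator DK1_sep.
Proof.
split.
- intros X Y HXY [n Hn]. exists n. now apply HXY.
- intros X Y [z Hz] [x Hx]. destruct (Hz x Hx) as [v [_ Hv]]. now exists v.
- apply (realizable (t := Lam (Lam (Var 1)))). intros m Hm Z [X [Y ->]] x Hx.
  apply Hm. intros m' Hm' y Hy. apply Hm'. exact Hx.
- apply (realizable
    (t := Lam (Lam (Lam (Var 2 @ Var 0 @ (Var 1 @ Var 0)))))).
  intros m Hm W [X [Y [Z ->]]] x Hx. apply Hm. intros m1 Hm1 y Hy.
  apply Hm1. intros m2 Hm2 z Hz. apply Hm2. cbn.
  eapply kapp_in_mono; [|exact (Hx z Hz)]. intros f Hf.
  eapply kapp_in_mono; [|exact (Hy z Hz)]. exact Hf.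
- (* The given function yields an element of each [b : B], possibly different
     ones, and none if [B] is empty.  Its eta-expansion is defined, and in every
     [b] because [b] is an implication. *)
  apply (realizable (t := Lam (Lam (Lam (Var 2 @ Var 1 @ Var 0))))).
  intros m Hm W [X [B [HB ->]]] z Hz. apply Hm. intros m1 Hm1 x Hx.
  apply Hm1. intros m2 Hm2 Y HY. destruct (HB Y HY) as [C [D ->]].
  intros y Hy. apply Hm2. cbn.
  eapply kapp_in_mono; [|exact (Hz _ (ex_intro _ _ (conj HY eq_refl)) x Hx)].
  intros f Hf. exact (Hf y Hy).
Qed.

(** The value that is in [Y] is also in [Z] because there is only one. *)
Lemma DK1_binary_implicative : binary_implicative DK1.
Proof.
intros X Y Z. apply ale_anti.
- apply meet_glb. split; apply arr_mono; try apply ale_refl;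
    apply (meet_glb Y Z (meet Y Z)), ale_refl.
- intros z Hz x Hx.
  destruct (Hz _ (or_introl eq_refl) x Hx) as [v [Hv HY]].
  destruct (Hz _ (or_intror eq_refl) x Hx) as [v' [Hv' HZ]].
  rewrite <- (kapp_functional Hv Hv') in HZ.
  exists v. split; [exact Hv|]. now intros W [-> | ->].
Qed.

(** * The arrow algebra of pairs, as a Kripke model *)

Notation pairs := (pair_structure DK1).
Notation modified := (mod_structure DK1).

(** A pair is a predicate over two levels, the actual realizers [false] and the
    potential ones [true], which grows from the first to the second; its
    implication is that of Kripke semantics. *)
Definition level (x : pairs) (k : bool) : nat -> Prop :=
  if k then pr1 x else pr0 x.

Lemma level_le x k k' n : Bool.le k k' -> level x k n -> level x k' n.
Proof.
destruct k, k'; cbn; auto; [discriminate|]. intros _. apply (pr_le x).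
Qed.

Lemma bool_le_refl k : Bool.le k k.
Proof. now destruct k. Qed.

Lemma bool_le_trans k k' k'' : Bool.le k k' -> Bool.le k' k'' -> Bool.le k k''.
Proof. destruct k, k', k''; cbn; congruence. Qed.

Lemma level_arr (x y : pairs) k n :
  level (x ~> y) k n <->
  forall k' m, Bool.le k k' -> level x k' m -> kapp_in n m (level y k').
Proof.
destruct k; cbn.
- split; [|intros H m; exact (H true m eq_refl)]. intros H k' m -> Hm. now apply H.
- split.
  + intros H [|] m _ Hm.
    * exact (H _ (or_intror eq_refl) m Hm).
    * exact (H _ (or_introl eq_refl) m Hm).
  + intros H X [-> | ->] m Hm; [exact (H false m I Hm)|exact (H true m I Hm)].
Qed.

Lemma level_inf (B : pairs -> Prop) k n :
  level (inf B) k n <-> forall x, B x -> level x k n.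
Proof.
destruct k; cbn; split.
- intros H x Hx. apply H. now exists x.
- intros H X [x [Hx ->]]. now apply H.
- intros H x Hx. apply H. now exists x.
- intros H X [x [Hx ->]]. now apply H.
Qed.

Lemma level_infI (I : Type) (phi : I -> pairs) k n :
  level (infI phi) k n <-> forall i, level (phi i) k n.
Proof.
unfold infI. rewrite level_inf. split.
- intros H i. apply H. now exists i.
- intros H x [i ->]. apply H.
Qed.

(** * The nucleus of the modification *)

(** The join with the pair of the empty and the full set, up to isomorphism:
    all that remains of its second summand is that it is potentially realized,
    which [0] records. *)
Definition maybe (x : pairs) (k : bool) (n : nat) : Prop :=
  match n with 0 => k = true | S n => level x k n end.

Lemma maybe_le x n : maybe x false n -> maybe x true n.
Proof. destruct n as [|n]; [discriminate|]. now apply level_le. Qed.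

Definition maybe_pair (x : pairs) : pairs :=
  @Pair DK1 (maybe x false) (maybe x true) (@maybe_le x).

Lemma level_maybe x k : level (maybe_pair x) k = maybe x k.
Proof. now destruct k. Qed.

Lemma kapp_level x y k n m :
  level (x ~> y) k n -> level x k m -> kapp_in n m (level y k).
Proof. intros H. apply (proj1 (level_arr _ _ _ _) H), bool_le_refl. Qed.

(** The join is a second-order encoding; instantiating it at [maybe_pair x]
    shows what it encodes. *)
Lemma mod_nucleus_out :
  exists r, forall x k n,
    level (mod_nucleus x) k n -> kapp_in r n (maybe x k).
Proof.
destruct (realizable_fun (Var 0 @ Lam (Suc (Var 0)) @ Lam (Num 0))) as [r Hr].
exists r. intros x k n Hn. apply Hr. cbn. intros f Hf.
apply (proj1 (level_infI _ _ _)) with (i := maybe_pair x) in Hn.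
eapply kapp_in_mono; [|apply (kapp_level Hn)].
- intros h Hh g Hg. rewrite <- level_maybe. apply (kapp_level Hh).
  apply level_arr. intros k' m _ Hm. apply Hg. rewrite level_maybe.
  destruct k'; [reflexivity|]. case (Hm (fun _ => False) I).
- apply level_arr. intros k' m _ Hm. apply Hf. now rewrite level_maybe.
Qed.

Lemma mod_nucleus_in :
  exists r, forall x k n,
    maybe x k n -> kapp_in r n (level (mod_nucleus x) k).
Proof.
destruct (realizable_fun
  (Lam (Lam (Case (Var 2) (Var 0 @ Num 0) (Var 2 @ Var 0))))) as [r Hr].
exists r. intros x k n Hn. apply Hr. intros m Hm.
apply level_infI. intros c. apply level_arr. intros k1 f Hk1 Hf.
apply Hm. intros m1 Hm1. apply level_arr. intros k2 g Hk2 Hg. apply Hm1. cbn.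
destruct n as [|n]; cbn in Hn.
- apply (kapp_level Hg). subst k. cbn in Hk1. subst k1. cbn in Hk2. subst k2.
  cbn. now intros X.
- apply (proj1 (level_arr _ _ _ _) Hf); [exact Hk2|].
  apply (level_le (k := k)); [|exact Hn]. now apply bool_le_trans with k1.
Qed.

(** Up to isomorphism the nucleus is the strong monad [maybe] on realizers; these
    are the term formers of its metalanguage, with their typing rules. *)
Record monad_terms : Type := {
  unit : term -> term;
  bind : term -> term -> term;
  realizes_unit : forall t l x k,
    realizes t l (level x k) -> realizes (unit t) l (level (mod_nucleus x) k);
  realizes_bind : forall t u l x y k,
    realizes t l (level (mod_nucleus x) k) ->
    (forall n, level x k n ->
      realizes u (n :: l) (level (mod_nucleus y) k)) ->
    realizes (bind t u) l (level (mod_nucleus y) k)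
}.

Lemma mod_nucleus_monad : inhabited monad_terms.
Proof.
destruct mod_nucleus_out as [p Hp], mod_nucleus_in as [q Hq].
constructor.
exists (fun t => Num q @ Suc t)
  (fun t u => Case (Num p @ t) (Num q @ Num 0) u); cbn.
- intros t l x k. apply realizes_mono. intros n Hn. now apply Hq.
- intros t u l x y k Ht Hu. revert Ht. apply realizes_mono. intros n Hn.
  eapply kapp_in_mono; [|exact (Hp _ _ _ Hn)]. intros [|m] Hm.
  + now apply Hq.
  + now apply Hu.
Qed.

Lemma realizes_lam t l x y k :
  (forall k' m, Bool.le k k' -> level x k' m ->
    realizes t (m :: l) (level y k')) ->
  realizes (Lam t) l (level (x ~> y) k).
Proof.
intros H f Hf. apply level_arr. intros k' m Hk' Hm. apply Hf. now apply H.
Qed.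

Lemma realizes_app t u l x y k :
  realizes t l (level (x ~> y) k) -> realizes u l (level x k) ->
  realizes (t @ u) l (level y k).
Proof.
intros Ht Hu. cbn. revert Ht. apply realizes_mono. intros m Hm.
revert Hu. apply realizes_mono. intros n. now apply kapp_level.
Qed.

Lemma mod_nucleus_is_nucleus :
  is_nucleus (pair_sep DK1_sep) (@mod_nucleus DK1).
Proof.
destruct mod_nucleus_monad as [M]. split.
- apply mod_nucleus_mono.
- apply (realizable (t := Lam (unit M (Var 0))) (X := level _ false)).
  intros m Hm. apply level_infI. intros x. revert m Hm. apply realizes_lam.
  intros k m _ Hm. now apply realizes_unit.
- apply (realizable (t := Lam (Lam (bind M (Var 0) (Var 2 @ Var 0))))
    (X := level _ false)).
  intros m Hm. apply level_inf. intros z [x [y ->]]. revert m Hm.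
  apply realizes_lam. intros k h _ Hh. apply realizes_lam. intros k' w Hk Hw.
  apply realizes_bind with x; [exact Hw|]. intros n Hn.
  apply (proj1 (level_arr _ _ _ _) Hh); assumption.
Qed.

(** Only [0] arises from the second summand of the join, and it is never an
    actual realizer. *)
Lemma mod_sep_level (x : modified) :
  mod_sep DK1_sep x <-> exists n, level x false n.
Proof.
split.
- intros [n Hn]. destruct mod_nucleus_out as [r Hr].
  destruct (Hr _ false _ Hn) as [[|m] [_ Hm]]; [discriminate|]. now exists m.
- intros [n Hn]. destruct mod_nucleus_in as [r Hr].
  destruct (Hr x false (S n) Hn) as [v [_ Hv]]. now exists v.
Qed.

Lemma realizable_mod_sep t (x : modified) :
  realizes t [] (level x false) -> mod_sep DK1_sep x.
Proof. intros H. now apply mod_sep_level, (realizable H). Qed.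

Lemma mod_is_separator : is_separator (mod_sep DK1_sep).
Proof.
destruct mod_nucleus_monad as [M]. split.
- intros x y Hxy. rewrite !mod_sep_level. intros [n Hn]. exists n.
  now apply (proj1 Hxy).
- intros x y. rewrite !mod_sep_level. intros [n Hn] [m Hm].
  destruct (kapp_level Hn Hm) as [v [_ Hv]].
  apply (proj1 (mod_sep_level y)). now exists v.
- apply realizable_mod_sep with (Lam (unit M (Lam (unit M (Var 1))))).
  intros m Hm. apply level_inf. intros z [x [y ->]]. revert m Hm.
  apply realizes_lam. intros k a _ Ha. apply realizes_unit.
  apply realizes_lam. intros k' b Hk Hb. apply realizes_unit.
  exact (level_le Hk Ha).
- apply realizable_mod_sep with (Lam (unit M (Lam (unit M (Lam
    (bind M (Var 2 @ Var 0) (bind M (Var 2 @ Var 1) (Var 1 @ Var 0)))))))).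
  intros m Hm. apply level_inf. intros w [x [y [z ->]]]. revert m Hm.
  apply realizes_lam. intros k a _ Ha. apply realizes_unit.
  apply realizes_lam. intros k1 b Hk1 Hb. apply realizes_unit.
  apply realizes_lam. intros k2 c Hk2 Hc.
  eapply realizes_bind.
  { eapply realizes_app; [|exact Hc].
    exact (level_le (bool_le_trans Hk1 Hk2) Ha). }
  intros f Hf. eapply realizes_bind.
  { eapply realizes_app; [|exact Hc]. exact (level_le Hk2 Hb). }
  intros d Hd. eapply realizes_app; [exact Hf|exact Hd].
- apply realizable_mod_sep with (Lam (unit M (Lam (unit M (Lam
    (bind M (Var 2 @ Var 1) (Var 0 @ Var 1))))))).
  intros m Hm. apply level_inf. intros w [x [B [HB ->]]]. revert m Hm.
  apply realizes_lam. intros k a _ Ha. apply realizes_unit.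
  apply realizes_lam. intros k1 b Hk1 Hb. apply realizes_unit.
  intros m Hm. apply level_inf. intros y Hy.
  pose proof (HB y Hy) as [c [d ->]]. revert m Hm.
  apply realizes_lam. intros k2 e Hk2 He.
  apply realizes_bind with (c ~> d).
  { eapply realizes_app; [|exact (level_le Hk2 Hb)].
    apply (level_le Hk2), (level_le Hk1).
    apply (proj1 (level_inf _ _ _) Ha). now exists (c ~> d). }
  intros f Hf. eapply realizes_app; [exact Hf|exact He].
Qed.

(** * Equivalence with modified realizability *)

Definition as_pair (X : Sigma_M) : pairs := @Pair DK1 (sm0 X) (sm1 X) (@sm_sub X).

Definition slevel (X : Sigma_M) : bool -> nat -> Prop := level (as_pair X).

Lemma slevel_le X k k' n : Bool.le k k' -> slevel X k n -> slevel X k' n.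
Proof. apply level_le. Qed.

Lemma slevel_zero X : slevel X true 0.
Proof. apply sm_zero. Qed.

Definition mk_sigma (P : bool -> nat -> Prop)
    (HP : forall n, P false n -> P true n) (H0 : P true 0) : Sigma_M :=
  {| sm0 := P false; sm1 := P true; sm_sub := HP; sm_zero := H0 |}.

Lemma slevel_mk P HP H0 k : slevel (@mk_sigma P HP H0) k = P k.
Proof. now destruct k. Qed.

Lemma grayson_le (I : Type) (x y : grayson I) :
  fle x y <->
  exists r, forall i k n, slevel (x i) k n -> kapp_in r n (slevel (y i) k).
Proof.
split; intros [r Hr]; exists r.
- intros i [|] n; apply (Hr i).
- intros i. split; [apply (Hr i true)|apply (Hr i false)].
Qed.

Lemma grayson_le_term t (I : Type) (x y : grayson I) :
  (forall i k n, slevel (x i) k n -> realizes t [n] (slevel (y i) k)) ->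
  fle x y.
Proof.
intros H. apply grayson_le. destruct (realizable_fun t) as [r Hr].
exists r. intros i k n Hn. apply Hr. now apply H.
Qed.

Lemma grayson_le_incl (I : Type) (x y : grayson I) :
  (forall i k n, slevel (x i) k n -> slevel (y i) k n) -> fle x y.
Proof. apply (grayson_le_term (t := Var 0)). Qed.

(** The order of the tripos of the modification, in the manner of the Kleisli
    category of a monad. *)
Lemma modified_le (I : Type) (x y : arrow_tripos (mod_sep DK1_sep) I) :
  fle x y <->
  exists r, forall i k n, level (x i) k n -> kapp_in r n (maybe (y i) k).
Proof.
change (fle x y) with
  (mod_sep DK1_sep (infI (A := modified) (fun i => x i ~> y i))).
rewrite mod_sep_level. split; intros [r Hr].
- destruct mod_nucleus_out as [p Hp].
  destruct (realizable_fun (Num p @ (Num r @ Var 0))) as [s Hs].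
  exists s. intros i k n Hn. apply Hs. cbn.
  apply (proj1 (level_infI _ _ _)) with (i := i) in Hr.
  eapply kapp_in_mono; [|exact (proj1 (level_arr _ _ _ _) Hr k n Logic.I Hn)].
  intros m Hm. now apply Hp.
- destruct mod_nucleus_in as [q Hq].
  apply (realizable (t := Lam (Num q @ (Num r @ Var 0)))).
  intros m Hm. apply level_infI. intros i. revert m Hm. apply realizes_lam.
  intros k n _ Hn. cbn. eapply kapp_in_mono; [|exact (Hr i k n Hn)].
  intros m Hm. now apply Hq.
Qed.

Lemma modified_le_term t (I : Type) (x y : arrow_tripos (mod_sep DK1_sep) I) :
  (forall i k n, level (x i) k n -> realizes t [n] (maybe (y i) k)) ->
  fle x y.
Proof.
intros H. apply modified_le. destruct (realizable_fun t) as [r Hr].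
exists r. intros i k n Hn. apply Hr. now apply H.
Qed.

Lemma grayson_refl (I : Type) (x : grayson I) : fle x x.
Proof. now apply grayson_le_incl. Qed.

Lemma grayson_trans (I : Type) (x y z : grayson I) :
  fle x y -> fle y z -> fle x z.
Proof.
rewrite !grayson_le. intros [r Hr] [s Hs].
apply grayson_le, (grayson_le_term (t := Num s @ (Num r @ Var 0))).
intros i k n Hn. cbn. eapply kapp_in_mono; [|exact (Hr i k n Hn)].
intros m Hm. now apply Hs.
Qed.

Lemma grayson_mono (I J : Type) (f : I -> J) (x y : grayson J) :
  fle x y -> fle (reindex f x) (reindex f y).
Proof. intros [r Hr]. exists r. intros i. apply Hr. Qed.

Lemma grayson_indexed : is_indexed_preorder grayson.
Proof.
split.
- exact grayson_refl.
- exact grayson_trans.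
- exact grayson_mono.
- intros I x. split; apply grayson_refl.
- intros I J K f g x. split; apply grayson_refl.
Qed.

Lemma modified_refl (I : Type) (x : arrow_tripos (mod_sep DK1_sep) I) : fle x x.
Proof. now apply (modified_le_term (t := Suc (Var 0))). Qed.

Lemma modified_indexed : is_indexed_preorder (arrow_tripos (mod_sep DK1_sep)).
Proof.
split.
- exact modified_refl.
- intros I x y z. rewrite !modified_le. intros [r Hr] [s Hs].
  apply modified_le, (modified_le_term
    (t := Case (Num r @ Var 0) (Num 0) (Num s @ Var 0))).
  intros i k n Hn. cbn. eapply kapp_in_mono; [|exact (Hr i k n Hn)].
  intros [|m] Hm; [exact Hm|now apply Hs].
- intros I J f x y. rewrite !modified_le. intros [r Hr]. exists r.
  intros i. apply Hr.
- intros I x. split; apply modified_refl.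
- intros I J K f g x. split; apply modified_refl.
Qed.

Definition maybe_sigma (x : pairs) : Sigma_M :=
  mk_sigma (P := maybe x) (@maybe_le x) eq_refl.

(** The inclusion of Grayson's truth values into the pairs has the pseudoinverse
    [maybe_sigma]: the element [0], which a truth value of Grayson potentially
    contains, serves as the value of the summand that [maybe] adds. *)
Lemma grayson_equivalent :
  indexed_equivalent grayson (arrow_tripos (mod_sep DK1_sep)).
Proof.
split; [exact grayson_indexed|]. split; [exact modified_indexed|].
exists (fun I x i => as_pair (x i)), (fun I x i => maybe_sigma (x i)).
split; [split|split; [split|split]].
- intros I x y. rewrite grayson_le. intros [r Hr].
  apply (modified_le_term (t := Suc (Num r @ Var 0))).
  intros i k n Hn. exact (Hr i k n Hn).
- intros I J f x. split; apply modified_refl.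
- intros I x y. rewrite modified_le. intros [r Hr].
  apply (grayson_le_term (t := Case (Var 0) (Num 0) (Num r @ Var 0))).
  intros i k n. unfold maybe_sigma. rewrite !slevel_mk.
  destruct n as [|n]; [auto|]. intros Hn. exact (Hr i k n Hn).
- intros I J f x. split; apply grayson_refl.
- intros I x. split.
  + apply (grayson_le_term (t := Case (Var 0) (Num 0) (Var 0))).
    intros i k n. unfold maybe_sigma. rewrite slevel_mk.
    destruct n as [|n]; cbn; [|auto]. intros ->. apply slevel_zero.
  + apply (grayson_le_term (t := Suc (Var 0))).
    intros i k n Hn. unfold maybe_sigma. now rewrite slevel_mk.
- intros I x. split.
  + apply (modified_le_term (t := Var 0)). intros i k n Hn.
    change (level (maybe_pair (x i)) k n) in Hn. now rewrite level_maybe in Hn.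
  + apply (modified_le_term (t := Suc (Suc (Var 0)))). intros i k n Hn. cbn.
    change (level (maybe_pair (x i)) k (S n)). now rewrite level_maybe.
Qed.

(** * The tripos of modified realizability *)

(** Top, meets, implications and right adjoints are all specified as elements
    that represent a condition on the elements below them; their duals are so
    in the opposite preorder. *)
Lemma representing_unique (T : Type) (le : T -> T -> Prop) (Phi : T -> Prop) a b :
  (forall z, le z z) ->
  (forall z, le z a <-> Phi z) -> (forall z, le z b <-> Phi z) ->
  le a b /\ le b a.
Proof. intros Hrefl Ha Hb. split; [apply Hb, Ha|apply Ha, Hb]; apply Hrefl. Qed.

(** With [representing_unique], this reduces the preservation of all meets, say,
    to that of chosen ones, which reindexing preserves strictly as they are
    computed pointwise. *)
Lemma representing_iso (T : Type) (le : T -> T -> Prop) (Phi : T -> Prop) a b :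
  (forall x y z, le x y -> le y z -> le x z) ->
  le a b -> le b a -> (forall z, le z a <-> Phi z) -> (forall z, le z b <-> Phi z).
Proof.
intros Htrans Hab Hba Ha z. rewrite <- Ha. split; intros H.
- exact (Htrans _ _ _ H Hba).
- exact (Htrans _ _ _ H Hab).
Qed.

Definition s_top : Sigma_M := mk_sigma (P := fun _ _ => True) (fun _ _ => I) I.

Definition s_bot : Sigma_M.
Proof. refine (mk_sigma (P := fun k n => k = true) _ eq_refl). discriminate. Defined.

Definition s_meet (X Y : Sigma_M) : Sigma_M.
Proof.
refine (mk_sigma (P := fun k n => slevel X k (p1 n) /\ slevel Y k (p2 n)) _ _).
- intros n [HX HY]. split; now apply (slevel_le (k := false)).
- split; apply slevel_zero.
Defined.

Definition s_join (X Y : Sigma_M) : Sigma_M.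
Proof.
refine (mk_sigma (P := fun k n =>
  match p1 n with 0 => slevel X k (p2 n) | S _ => slevel Y k (p2 n) end) _ _).
- intros n. destruct (p1 n); now apply slevel_le.
- apply slevel_zero.
Defined.

Definition s_imp (X Y : Sigma_M) : Sigma_M.
Proof.
refine (mk_sigma (P := fun k n => forall k' m, Bool.le k k' -> slevel X k' m ->
  kapp_in n m (slevel Y k')) _ _).
- intros n H k' m _. now apply H.
- intros k' m Hk _. cbn in Hk. subst k'. apply kapp_in_0, slevel_zero.
Defined.

(** The successor keeps the elements of the union apart from the additional [0],
    on which a realizer that is given on the members of the family need not be
    defined. *)
Definition s_exists (I : Type) (D : I -> Prop) (x : I -> Sigma_M) : Sigma_M.
Proof.
refine (mk_sigma (P := fun k n => match n with
  | 0 => k = true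
  | S n => exists i, D i /\ slevel (x i) k n end) _ eq_refl).
intros [|n]; [discriminate|]. intros [i [Hi Hn]]. exists i. split; [exact Hi|].
now apply (slevel_le (k := false)).
Defined.

(** The intersection over [D], delayed by a dummy argument: if [D] is empty, then
    every number is in it, and a realizer for the members of the family need not
    be defined there. *)
Definition s_forall (I : Type) (D : I -> Prop) (x : I -> Sigma_M) : Sigma_M.
Proof.
refine (mk_sigma (P := fun k n =>
  forall i m, D i -> kapp_in n m (slevel (x i) k)) _ _).
- intros n H i m Hi. eapply kapp_in_mono; [|exact (H i m Hi)].
  intros v. now apply slevel_le.
- intros i m _. apply kapp_in_0, slevel_zero.
Defined.

Lemma s_top_is_top (I : Type) : is_top (@fle grayson I) (fun _ => s_top).
Proof.
intros x. apply (grayson_le_term (t := Num 0)). intros i k n _.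
unfold s_top. now rewrite slevel_mk.
Qed.

Lemma s_bot_is_bot (I : Type) : is_bot (@fle grayson I) (fun _ => s_bot).
Proof.
intros x. apply (grayson_le_term (t := Num 0)). intros i k n.
unfold s_bot. rewrite slevel_mk. intros ->. apply slevel_zero.
Qed.

Lemma s_meet_is_meet (I : Type) (x y : grayson I) :
  is_meet (@fle grayson I) x y (fun i => s_meet (x i) (y i)).
Proof.
intros z. split.
- intros H. split; eapply grayson_trans; try exact H.
  + apply (grayson_le_term (t := Fst (Var 0))). intros i k n.
    unfold s_meet. rewrite slevel_mk. tauto.
  + apply (grayson_le_term (t := Snd (Var 0))). intros i k n.
    unfold s_meet. rewrite slevel_mk. tauto.
- rewrite !grayson_le. intros [[r Hr] [s Hs]].
  apply grayson_le, (grayson_le_term (t := Pr (Num r @ Var 0) (Num s @ Var 0))).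
  intros i k n Hn. cbn. eapply kapp_in_mono; [|exact (Hr i k n Hn)].
  intros u Hu. eapply kapp_in_mono; [|exact (Hs i k n Hn)]. intros v Hv.
  unfold s_meet. now rewrite slevel_mk, p1_pair, p2_pair.
Qed.

Lemma s_join_is_join (I : Type) (x y : grayson I) :
  is_join (@fle grayson I) x y (fun i => s_join (x i) (y i)).
Proof.
intros z. split.
- intros H. split; eapply grayson_trans; try exact H.
  + apply (grayson_le_term (t := Pr (Num 0) (Var 0))). intros i k n Hn. cbn.
    unfold s_join. now rewrite slevel_mk, p1_pair, p2_pair.
  + apply (grayson_le_term (t := Pr (Num 1) (Var 0))). intros i k n Hn. cbn.
    unfold s_join. now rewrite slevel_mk, p1_pair, p2_pair.
- rewrite !grayson_le. intros [[r Hr] [s Hs]].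
  apply grayson_le, (grayson_le_term (t := Case (Fst (Var 0))
    (Num r @ Snd (Var 0)) (Num s @ Snd (Var 1)))).
  intros i k n. unfold s_join. rewrite slevel_mk. cbn.
  destruct (p1 n); cbn; auto.
Qed.

Lemma s_imp_represents (I : Type) (x y z : grayson I) :
  fle z (fun i => s_imp (x i) (y i)) <->
  @fle grayson I (fun i => s_meet (z i) (x i)) y.
Proof.
rewrite !grayson_le. split; intros [r Hr].
- apply grayson_le,
    (grayson_le_term (t := Num r @ Fst (Var 0) @ Snd (Var 0))).
  intros i k n. unfold s_meet. rewrite slevel_mk. intros [Hz Hx]. cbn.
  eapply kapp_in_mono; [|exact (Hr i k _ Hz)]. intros h Hh.
  unfold s_imp in Hh. rewrite slevel_mk in Hh.
  apply Hh; [apply bool_le_refl|exact Hx].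
- apply grayson_le, (grayson_le_term (t := Lam (Num r @ Pr (Var 1) (Var 0)))).
  intros i k n Hn h Hh. unfold s_imp. rewrite slevel_mk. intros k' m Hk Hm.
  apply Hh. apply Hr. unfold s_meet. rewrite slevel_mk, p1_pair, p2_pair.
  split; [exact (slevel_le Hk Hn)|exact Hm].
Qed.

Lemma s_imp_is_imp (I : Type) (x y : grayson I) :
  is_imp (@fle grayson I) x y (fun i => s_imp (x i) (y i)).
Proof.
intros z m Hm. rewrite s_imp_represents.
destruct (representing_unique (@grayson_refl I) Hm (s_meet_is_meet z x))
  as [H1 H2].
split; intros H; eapply grayson_trans; eassumption.
Qed.

Lemma grayson_heyting (I : Type) : is_heyting (@fle grayson I).
Proof.
split.
- exists (fun _ => s_top). apply s_top_is_top.
- exists (fun _ => s_bot). apply s_bot_is_bot.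
- intros x y. eexists. apply s_meet_is_meet.
- intros x y. eexists. apply s_join_is_join.
- intros x y. eexists. apply s_imp_is_imp.
Qed.

Lemma grayson_preserves (I J : Type) (f : I -> J) :
  preserves_heyting (@fle grayson J) (@fle grayson I) (reindex f).
Proof.
split.
- intros t Ht x. eapply grayson_trans; [apply s_top_is_top|].
  exact (grayson_mono f (Ht (fun _ => s_top))).
- intros b Hb x. eapply grayson_trans; [|apply s_bot_is_bot].
  exact (grayson_mono f (Hb (fun _ => s_bot))).
- intros x y m Hm.
  destruct (representing_unique (@grayson_refl J) Hm (s_meet_is_meet x y))
    as [H1 H2].
  exact (representing_iso (@grayson_trans I) (grayson_mono f H2)
    (grayson_mono f H1) (s_meet_is_meet (reindex f x) (reindex f y))).
- intros x y j Hj.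
  destruct (representing_unique (le := fun a b => fle b a) (@grayson_refl J) Hj
    (s_join_is_join x y)) as [H1 H2].
  exact (representing_iso (le := fun a b => fle b a)
    (fun a b c Hab Hbc => grayson_trans Hbc Hab) (grayson_mono f H2)
    (grayson_mono f H1) (s_join_is_join (reindex f x) (reindex f y))).
- intros x y h Hh z m Hm.
  destruct (representing_unique (@grayson_refl J)
    (fun z => Hh z _ (s_meet_is_meet z x)) (s_imp_represents x y)) as [H1 H2].
  rewrite <- (@s_imp_is_imp I (reindex f x) (reindex f y) z m Hm).
  split; intros H; refine (grayson_trans H _);
    [exact (grayson_mono f H1)|exact (grayson_mono f H2)].
Qed.

Lemma s_exists_is_exists (I J : Type) (f : I -> J) :
  is_exists (P := grayson) f
    (fun x j => s_exists (fun i => f i = j) x).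
Proof.
intros x y. rewrite !grayson_le. split; intros [r Hr].
- apply grayson_le, (grayson_le_term (t := Num r @ Suc (Var 0))).
  intros i k n Hn. cbn. apply Hr. unfold s_exists. rewrite slevel_mk.
  now exists i.
- apply grayson_le,
    (grayson_le_term (t := Case (Var 0) (Num 0) (Num r @ Var 0))).
  intros j k n. unfold s_exists. rewrite slevel_mk. destruct n as [|n]; cbn.
  + intros ->. apply slevel_zero.
  + intros [i [<- Hn]]. exact (Hr i k n Hn).
Qed.

Lemma s_forall_is_forall (I J : Type) (f : I -> J) :
  is_forall (P := grayson) f
    (fun x j => s_forall (fun i => f i = j) x).
Proof.
intros x y. rewrite !grayson_le. split; intros [r Hr].
- apply grayson_le, (grayson_le_term (t := Num r @ Var 0 @ Num 0)).
  intros i k n Hn. cbn. eapply kapp_in_mono; [|exact (Hr (f i) k n Hn)].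
  intros h. unfold s_forall. rewrite slevel_mk. intros Hh. now apply Hh.
- apply grayson_le, (grayson_le_term (t := Lam (Num r @ Var 1))).
  intros j k n Hn h Hh. unfold s_forall. rewrite slevel_mk. intros i m <-.
  apply Hh. exact (Hr i k n Hn).
Qed.

Lemma pullback_sym X I J K (p : X -> I) (q : X -> J) (f : I -> K) (g : J -> K) x j :
  is_pullback p q f g -> q x = j -> f (p x) = g j.
Proof. intros [H _] <-. apply H. Qed.

Lemma grayson_exists_bc X I J K (p : X -> I) (q : X -> J) (f : I -> K)
    (g : J -> K) (Ef : grayson I -> grayson K) (Eq : grayson X -> grayson J) :
  is_pullback p q f g ->
  is_exists (P := grayson) f Ef -> is_exists (P := grayson) q Eq ->
  forall x : grayson I, fiso (reindex g (Ef x)) (Eq (reindex p x)).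
Proof.
intros Hpb HEf HEq x.
destruct (representing_unique (le := fun a b => fle b a) (@grayson_refl K)
  (HEf x) (s_exists_is_exists f x)) as [Hf1 Hf2].
destruct (representing_unique (le := fun a b => fle b a) (@grayson_refl J)
  (HEq (reindex p x)) (s_exists_is_exists q (reindex p x))) as [Hq1 Hq2].
apply (grayson_mono g) in Hf1, Hf2. split.
- apply (grayson_trans Hf2). refine (grayson_trans _ Hq1).
  apply grayson_le_incl. intros j k n. unfold reindex, s_exists; cbn.
  rewrite !slevel_mk. destruct n as [|n]; [auto|]. intros [i [Hi Hn]].
  destruct (proj2 Hpb i j Hi) as [u [[<- <-] _]]. now exists u.
- apply (grayson_trans Hq2). refine (grayson_trans _ Hf1).
  apply grayson_le_incl. intros j k n. unfold reindex, s_exists; cbn.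
  rewrite !slevel_mk. destruct n as [|n]; [auto|]. intros [u [Hu Hn]].
  exists (p u). split; [exact (pullback_sym Hpb Hu)|exact Hn].
Qed.

Lemma grayson_forall_bc X I J K (p : X -> I) (q : X -> J) (f : I -> K)
    (g : J -> K) (Af : grayson I -> grayson K) (Aq : grayson X -> grayson J) :
  is_pullback p q f g ->
  is_forall (P := grayson) f Af -> is_forall (P := grayson) q Aq ->
  forall x : grayson I, fiso (reindex g (Af x)) (Aq (reindex p x)).
Proof.
intros Hpb HAf HAq x.
destruct (representing_unique (@grayson_refl K) (HAf x)
  (s_forall_is_forall f x)) as [Hf1 Hf2].
destruct (representing_unique (@grayson_refl J) (HAq (reindex p x))
  (s_forall_is_forall q (reindex p x))) as [Hq1 Hq2].
apply (grayson_mono g) in Hf1, Hf2. split.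
- apply (grayson_trans Hf1). refine (grayson_trans _ Hq2).
  apply grayson_le_incl. intros j k n. unfold reindex, s_forall; cbn.
  rewrite !slevel_mk. intros H u m Hu. apply H. exact (pullback_sym Hpb Hu).
- apply (grayson_trans Hq1). refine (grayson_trans _ Hf2).
  apply grayson_le_incl. intros j k n. unfold reindex, s_forall; cbn.
  rewrite !slevel_mk. intros H i m Hi.
  destruct (proj2 Hpb i j Hi) as [u [[<- <-] _]]. now apply H.
Qed.

Lemma grayson_tripos : is_tripos grayson.
Proof.
split.
- exact grayson_indexed.
- exact grayson_heyting.
- exact grayson_preserves.
- intros I J f. eexists. apply s_exists_is_exists.
- intros I J f. eexists. apply s_forall_is_forall.
- intros X I J K p q f g Hpb Ef Eq. now apply grayson_exists_bc.
- intros X I J K p q f g Hpb Af Aq. now apply grayson_forall_bc.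
- exists Sigma_M, (fun X => X). intros I x. exists x. split; apply grayson_refl.
Qed.

Theorem proposition7p6 :
  is_separator DK1_sep /\
  binary_implicative DK1 /\
  is_nucleus (pair_sep DK1_sep) (@mod_nucleus DK1) /\
  is_separator (mod_sep DK1_sep) /\
  indexed_equivalent grayson (arrow_tripos (mod_sep DK1_sep)) /\
  is_tripos grayson.
Proof.
split; [exact DK1_is_separator|]. split; [exact DK1_binary_implicative|].
split; [exact mod_nucleus_is_nucleus|]. split; [exact mod_is_separator|].
split; [exact grayson_equivalent|exact grayson_tripos].
Qed.
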